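(* Every (finite) matroid $M$ admits a lean tree-decomposition of width $\mathrm{tw}(M)$.
   Context: Let $M$ be a matroid on ground set $E$ with rank function $r$. A tree-decomposition of $M$ (in the sense of Hliněný and Whittle) is a pair $(T,\tau)$ where $T$ is a finite tree and $\tau:E\to V(T)$ is an arbitrary map. For $v\in V(T)$, let $T_1,\dots,T_d$ be the components of $T-v$; the width of $v$ is $\sum_{i=1}^d r(E\setminus\tau^{-1}(V(T_i)))-(d-1)\,r(E)$. The width of $(T,\tau)$ is the maximum width of its vertices, and the tree-width $\mathrm{tw}(M)$ is the smallest width of a tree-decomposition of $M$. For $X\subseteq E$ let $\lambda(X)=r(X)+r(E\setminus X)-r(E)$. For subsets $Z_1,Z_2\subseteq E$ let $\lambda(Z_1,Z_2)=\min\{\lambda(X): Z_1\subseteq X,\ Z_2\subseteq E\setminus X\}$ (taken to be $+\infty$ if no such $X$ exists, i.e. if $Z_1\cap Z_2\neq\emptyset$). For an edge $ss'$ of $T$, let $T_1$ be the component of $T-s'$ containing $s$ and $T_2$ the component of $T-s$ containing $s'$; the edge $ss'$ induces the bipartition $(\tau^{-1}(V(T_1)),\tau^{-1}(V(T_2)))$ of $E$, and this is a ''$<k$ separation'' if $\lambda(\tau^{-1}(V(T_1)))<k$. The tree-decomposition $(T,\tau)$ is lean if for all $k\in\mathbb N$, all $t,t'\in V(T)$ and all subsets $Z_1\subseteq\tau^{-1}(t)$, $Z_2\subseteq\tau^{-1}(t')$ with $r(Z_1)=r(Z_2)=k$, either $\lambda(Z_1,Z_2)\ge k$ or there is an edge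 $ss'$ on the path $tTt'$ whose induced bipartition is a $<k$ separation. *)

(* Defs.v *)
From mathcomp Require Import all_boot all_order all_algebra.
From mathcomp Require Import boolp constructive_ereal.

Set Implicit Arguments.
Unset Strict Implicit.
Unset Printing Implicit Defensive.

Import Order.TTheory GRing.Theory Num.Theory.

Local Open Scope ring_scope.

(* The ground set is the whole finite type E. *)
Record matroid (E : finType) := Matroid {
  indep : pred {set E};
  indep0 : indep set0;
  indep_sub : forall I J : {set E}, J \subset I -> indep I -> indep J;
  indep_aug : forall I J : {set E}, indep I -> indep J -> (#|I| < #|J|)%N ->
    exists2 x, x \in J :\: I & indep (x |: I)
}.

Definition rank (E : finType) (M : matroid E) (X : {set E}) : nat :=
  \max_(I : {set E} | indep M I && (I \subset X)) #|I|.

Definition conn (E : finType) (M : matroid E) (X : {set E}) : int :=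
  (rank M X)%:Z + (rank M (~: X))%:Z - (rank M [set: E])%:Z.

Definition conn2 (E : finType) (M : matroid E) (Z1 Z2 : {set E}) : \bar int :=
  \big[Order.min/+oo%E]_(X : {set E} | (Z1 \subset X) && (Z2 \subset ~: X))
    (conn M X)%:E.

Record tree := Tree {
  vertex :> finType;
  adj : rel vertex;
  tree_nonempty : (0 < #|vertex|)%N;
  adj_sym : symmetric adj;
  adj_irr : irreflexive adj;
  tree_connected : forall x y, connect adj x y;
  (* a sequence of two adjacent vertices is a ucycle of a symmetric relation *)
  tree_acyclic : forall c : seq vertex, ucycle adj c -> (size c <= 2)%N
}.

Record tree_decomposition (E : finType) := TreeDecomposition {
  td_tree : tree;
  td_map : E -> td_tree
}.

Definition adj_minus (T : tree) (v : T) : rel T :=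
  [rel x y | [&& x != v, y != v & adj x y]].

(* The component of T - v containing u; only meaningful for u != v. *)
Definition component (T : tree) (v u : T) : {set T} :=
  [set w | connect (adj_minus v) u w].

Definition components (T : tree) (v : T) : {set {set T}} :=
  [set component v u | u in [set~ v]].

Definition td_preim (E : finType) (D : tree_decomposition E)
  (C : {set td_tree D}) : {set E} := [set x | td_map D x \in C].

Definition vertex_width (E : finType) (M : matroid E)
    (D : tree_decomposition E) (v : td_tree D) : int :=
  \sum_(C in components v) (rank M (~: td_preim C))%:Z
    - (#|components v|%:Z - 1) * (rank M [set: E])%:Z.

(* The default value 0 is harmless, see widthP below. *)
Definition width (E : finType) (M : matroid E) (D : tree_decomposition E) : int :=
  \big[Order.max/0]_(v : td_tree D) vertex_width M v.

Definition tree_path (T : tree) (t t' : T) (p : seq T) : Prop :=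
  [/\ path (@adj T) t p, uniq (t :: p) & last t p = t'].

Definition edge_on_path (T : tree) (t t' s s' : T) : Prop :=
  exists2 p : seq T, tree_path t t' p & infix [:: s; s'] (t :: p).

Definition lean (E : finType) (M : matroid E) (D : tree_decomposition E) : Prop :=
  forall (k : nat) (t t' : td_tree D) (Z1 Z2 : {set E}),
    Z1 \subset td_preim [set t] -> Z2 \subset td_preim [set t'] ->
    rank M Z1 = k -> rank M Z2 = k ->
    (k%:Z%:E <= conn2 M Z1 Z2)%E \/
    exists s s' : td_tree D, edge_on_path t t' s s' /\
      conn M (td_preim (component s' s)) < k%:Z.

Section RankFacts.
Variables (E : finType) (M : matroid E).
Implicit Types (I J X Y : {set E}).

Lemma rank_indep I X : indep M I -> I \subset X -> (#|I| <= rank M X)%N.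
Proof. by move=> iI sI; apply: leq_bigmax_cond; rewrite iI. Qed.

Lemma rank_basis X : exists I, [/\ indep M I, I \subset X & #|I| = rank M X].
Proof.
have h : (0 < #|[pred I : {set E} | indep M I && (I \subset X)]|)%N.
  by apply/card_gt0P; exists set0; rewrite inE indep0 sub0set.
by case: (eq_bigmax_cond (fun I : {set E} => #|I|) h) => I /andP[? ?] eI; exists I.
Qed.

Lemma indep_extend I X : indep M I -> I \subset X ->
  exists J, [/\ indep M J, I \subset J, J \subset X & #|J| = rank M X].
Proof.
move eqn: (rank M X - #|I|)%N => n.
elim: n I eqn => [|n IHn] I eqn iI sI.
  exists I; split=> //; apply/eqP; rewrite eqn_leq rank_indep //=.
  by rewrite -subn_eq0 eqn.
have [B [iB sB cB]] := rank_basis X.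
have ltIB : (#|I| < #|B|)%N by rewrite cB -subn_gt0 eqn.
have [x /setDP[xB xI] ixI] := indep_aug iI iB ltIB.
have sxI : x |: I \subset X by rewrite subUset sub1set (subsetP sB).
have [|J [iJ sJ sJX cJ]] := IHn (x |: I) _ ixI sxI.
  by rewrite cardsU1 xI add1n subnS eqn.
by exists J; split=> //; apply: subset_trans sJ; apply: subsetUr.
Qed.

Lemma rank_submod X Y :
  (rank M (X :|: Y) + rank M (X :&: Y) <= rank M X + rank M Y)%N.
Proof.
have [I [iI sI cI]] := rank_basis (X :&: Y).
have sIU : I \subset X :|: Y.
  by apply: (subset_trans sI); rewrite subIset // subsetUl.
have [J [iJ sIJ sJ cJ]] := indep_extend iI sIU.
have rX : (#|J :&: X| <= rank M X)%N.
  by rewrite rank_indep ?subsetIr // (indep_sub _ iJ) ?subsetIl.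
have rY : (#|J :&: Y| <= rank M Y)%N.
  by rewrite rank_indep ?subsetIr // (indep_sub _ iJ) ?subsetIl.
apply: leq_trans (leq_add rX rY).
rewrite -cardsUI -setIUr -setIIr (setIidPl sJ) cJ leq_add2l -cI.
by apply: subset_leq_card; rewrite subsetI sIJ.
Qed.

Lemma rank_coverC (s : seq {set E}) : pairwise (fun X Y : {set E} => [disjoint X & Y]) s ->
  (rank M (~: \bigcup_(X <- s) X) + size s * rank M [set: E] <=
   \sum_(X <- s) rank M (~: X) + rank M [set: E])%N.
Proof.
elim: s => [|X s IHs] /=; first by rewrite !big_nil setC0 mul0n addnC.
case/andP=> /allP dX /IHs {IHs}; set U := \bigcup_(Y <- s) Y => IHs.
have dXU : [disjoint X & U].
  rewrite /U big_seq; elim/big_ind: _ => [|A B dA dB|Y /dX //].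
    by rewrite -setI_eq0 setI0.
  by rewrite -setI_eq0 setIUr setU_eq0 !setI_eq0 dA.
rewrite !big_cons -/U setCU mulSn.
have := rank_submod (~: X) (~: U).
rewrite -setCI (disjoint_setI0 dXU) setC0.
set rE := rank M [set: E] in IHs *; set a := rank M (_ :&: _) => h.
rewrite addnA (addnC a) -addnA.
apply: leq_trans (_ : rank M (~: X) + (rank M (~: U) + size s * rE) <= _)%N.
  by rewrite !addnA leq_add2r.
by rewrite -addnA leq_add2l.
Qed.

End RankFacts.

Lemma components_disjoint (T : tree) (v : T) (A B : {set T}) :
  A \in components v -> B \in components v -> A != B -> [disjoint A & B].
Proof.
case/imsetP=> a _ -> /imsetP[b _ ->]; apply: contraR.
have cs : connect_sym (adj_minus v).
  apply: sym_connect_sym => x y /=.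
  by rewrite /adj_minus /= adj_sym; case: (x != v); case: (y != v).
rewrite -setI_eq0 => /set0Pn[w]; rewrite !inE => /andP[aw bw].
apply/eqP/setP=> z; rewrite !inE.
by rewrite (same_connect cs aw) (same_connect cs bw).
Qed.

Section WidthFacts.
Variables (E : finType) (M : matroid E).
Implicit Type D : tree_decomposition E.

Lemma vertex_width_ge0 D (v : td_tree D) : 0 <= vertex_width M v.
Proof.
have : pairwise (fun X Y : {set E} => [disjoint X & Y])
    [seq td_preim C | C <- enum (components v)].
  rewrite pairwise_map; apply: (@sub_in_pairwise _ (mem (components v)) (fun A B => A != B)).
  - move=> A B Av Bv nAB /=; have := components_disjoint Av Bv nAB.
    rewrite -!setI_eq0 => /eqP AB0; apply/eqP/setP=> x; rewrite !inE.
    by have /setP/(_ (td_map D x)) := AB0; rewrite !inE.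
  - by apply/allP=> A; rewrite mem_enum.
  - by rewrite -uniq_pairwise enum_uniq.
move=> /(rank_coverC M); rewrite size_map -cardE big_map [X in (_ <= X + _)%N]big_map.
rewrite !big_enum /= => h.
rewrite /vertex_width mulrBl mul1r opprB addrA subr_ge0 addrC -PoszM.
apply: le_trans (_ : (\sum_(C in components v) rank M (~: td_preim C)
    + rank M [set: E])%N%:Z <= _).
  by rewrite lez_nat; apply: leq_trans h; apply: leq_addl.
by rewrite PoszD addrC (big_morph Posz PoszD (erefl _)).
Qed.

Lemma width_ge0 D : 0 <= width M D.
Proof. exact: bigmax_ge_id. Qed.

Lemma widthP D : (forall v : td_tree D, vertex_width M v <= width M D) /\
  exists v : td_tree D, vertex_width M v = width M D.
Proof.
split=> [v|]; first exact: le_bigmax.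
have /card_gt0P[v0 _] := tree_nonempty (td_tree D).
have [|v _ eqv] := @eq_bigmax _ _ _ 0 v0 predT (@vertex_width E M D) isT.
  by move=> v _; apply: vertex_width_ge0.
by exists v; rewrite -eqv.
Qed.

End WidthFacts.

Lemma unit_nonempty : (0 < #|{: unit}|)%N.
Proof. by rewrite card_unit. Qed.

Lemma unit_connected (e : rel unit) x y : connect e x y.
Proof. by case: x; case: y. Qed.

Lemma unit_acyclic (c : seq unit) :
  ucycle (fun _ _ : unit => false) c -> (size c <= 2)%N.
Proof. by case: c => [|[] [|[] c]] //= /andP[]. Qed.

Definition unit_tree : tree :=
  @Tree unit (fun _ _ => false) unit_nonempty (fun _ _ => erefl)
    (fun _ => erefl) (unit_connected _) unit_acyclic.

Lemma ex_width (E : finType) (M : matroid E) :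
  exists n : nat, `[< exists D : tree_decomposition E, width M D = n%:Z >].
Proof.
pose D := TreeDecomposition (fun _ : E => (tt : unit_tree)).
exists `|width M D|%N; apply/asboolP; exists D.
by rewrite gez0_abs // width_ge0.
Qed.

(* All widths are nonnegative, so the least width is found by ex_minn. *)
Definition tw (E : finType) (M : matroid E) : nat := ex_minn (ex_width M).

Lemma twP (E : finType) (M : matroid E) :
  (exists D : tree_decomposition E, width M D = (tw M)%:Z) /\
  forall D : tree_decomposition E, (tw M)%:Z <= width M D.
Proof.
rewrite /tw; case: ex_minnP => n /asboolP exn minn; split=> // D.
rewrite -(gez0_abs (width_ge0 M D)) lez_nat; apply: minn.
by apply/asboolP; exists D; rewrite gez0_abs // width_ge0.
Qed.

(* Main.v *)
Require Import Defs.
From mathcomp Require Import all_boot all_order all_algebra.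
From mathcomp Require Import boolp constructive_ereal zify.

(** The argument follows Bellenbaum and Diestel. Write [d A := r E - r (E \ A)]:
    it is monotone and supermodular, the width of a vertex is [r E] minus the sum
    of [d] over the parts behind the components at that vertex, and
    [conn X = r E - d X - d (E \ X)], so that an edge behaves like a vertex with two
    parts.

    Take a decomposition of width [tw M] such that, reading [p] downwards, the number
    of vertices of width at least [p] plus edges of order at least [p] is
    lexicographically minimal. If it is not lean, witnessed by [k, t, t', Z1, Z2],
    let [X] separate [Z1] from [Z2] with [conn X] minimal and, subject to this, with
    as few sides of edges off the path from [t] to [t'] crossed as possible. Take two
    copies of the tree, put [X] in the first and its complement in the second, and
    join the vertex [t'] of the first to the vertex [t] of the second.
    Minimality of [conn X] shows that no vertex or edge gets larger in either copy,
    and minimal crossing that whenever one copy keeps its size, one of the two copies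
    has size at most [conn X < k]. Finally some vertex or edge of size at least [k]
    shrinks in both copies, contradicting the choice of the decomposition. *)

Set Implicit Arguments.
Unset Strict Implicit.
Unset Printing Implicit Defensive.

Import Order.TTheory GRing.Theory Num.Theory.

(** * Components in trees *)

Section TreeFacts.
Variable T : tree.
Implicit Types (s t u v w x y : T) (S C : {set T}) (p : seq T).

Lemma adj_neq x y : adj x y -> x != y.
Proof. by apply: contraTneq => ->; rewrite adj_irr. Qed.

Lemma adj_minus_sym v : symmetric (adj_minus v).
Proof. by move=> x y; rewrite /adj_minus /= adj_sym andbCA. Qed.

Lemma adj_minus_connect_sym v : connect_sym (adj_minus v).
Proof. exact/sym_connect_sym/adj_minus_sym. Qed.

Lemma mem_component v u : u \in component v u.
Proof. by rewrite inE connect0. Qed.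

Lemma component_eq v u w : w \in component v u -> component v w = component v u.
Proof.
rewrite inE => uw; apply/setP => z.
by rewrite !inE (same_connect (adj_minus_connect_sym v) uw).
Qed.

Lemma component_sym v u w : (w \in component v u) = (u \in component v w).
Proof. by rewrite !inE adj_minus_connect_sym. Qed.

Lemma adj_minus_path v u p : path (@adj T) u p -> v \notin u :: p ->
  path (adj_minus v) u p.
Proof.
elim: p u => //= w p IHp u /andP[uw wp]; rewrite !inE !negb_or => /and3P[vu vw vp].
by rewrite /adj_minus /= uw (eq_sym u) vu (eq_sym w) vw IHp // inE negb_or vw.
Qed.

Lemma path_component v u p : path (@adj T) u p -> v \notin u :: p ->
  last u p \in component v u.
Proof.
by move=> up vp; rewrite inE; apply/connectP; exists p => //; exact: adj_minus_path.
Qed.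

Lemma center_notin_component v u : u != v -> v \notin component v u.
Proof.
move=> uv; rewrite inE adj_minus_connect_sym; apply: contraNN uv => /connectP[].
by case=> [_ ->|w p] //=; rewrite /adj_minus /= eqxx.
Qed.

Lemma component_center v : component v v = [set v].
Proof.
apply/setP => u; rewrite !inE; apply/idP/eqP => [|->]; last exact: connect0.
by case/connectP => -[//|w p] /=; rewrite /adj_minus /= eqxx.
Qed.

Lemma component_in v u : u != v -> component v u \in components v.
Proof. by move=> uv; apply/imsetP; exists u; rewrite // !inE. Qed.

Lemma componentsP v C : C \in components v -> [/\ v \notin C,
  forall u, u \in C -> C = component v u & exists2 u, adj v u & C = component v u].
Proof.
case/imsetP => w; rewrite !inE => wv ->; split; first exact: center_notin_component.
  by move=> u /component_eq.
have /connectP[p0 /shortenP[p vp up _] def_w] := tree_connected v w.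
case: p vp up def_w => [|u p] /=; first by move=> _ _ wv0; rewrite wv0 eqxx in wv.
case/andP => vu up /andP[vp _] def_w; exists u => //.
by rewrite def_w; apply/component_eq/path_component.
Qed.

Lemma component_sub v u x w : x \notin component v u -> w \in component v u ->
  component v u \subset component x w.
Proof.
move=> xC wC; apply/subsetP => z; rewrite -(component_eq wC) inE => /connectP[p wp ->].
apply: path_component; first by apply: sub_path wp => a b /and3P[].
apply: contraNN xC => /splitPl xp; case: xp wp => p1 p2 def_x.
rewrite cat_path => /andP[wp1 _]; rewrite -(component_eq wC) inE -def_x.
by apply/connectP; exists p1.
Qed.

(** A vertex on both sides would give a walk from [y] to [x] not using the edge [xy], hence a cycle.
    Conversely, a simple path from [x] either avoids [y] or, from [y] onwards, avoids [x]. *)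
Lemma componentC x y : adj x y -> component y x = ~: component x y.
Proof.
move=> xy; have nxy := adj_neq xy.
apply/setP => w; rewrite [RHS]inE; apply/idP/idP => [wx|].
  apply/negP => wy.
  pose e := [rel a b | adj a b && ~~ ((a == y) && (b == x)) && ~~ ((a == x) && (b == y))].
  have sx : subrel (adj_minus x) e.
    by move=> a b /and3P[/negPf ax /negPf bx ab]; rewrite /= ab ax bx andbF.
  have sy : subrel (adj_minus y) e.
    by move=> a b /and3P[/negPf ax /negPf bx ab]; rewrite /= ab ax bx andbF.
  have conn_sub (e1 e2 : rel T) : subrel e1 e2 -> subrel (connect e1) (connect e2).
    by move=> h; apply: connect_sub => a b /h/connect1.
  have : connect e y x.
    rewrite !inE in wx wy; apply: connect_trans (conn_sub _ _ sx _ _ wy) _.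
    by apply: conn_sub sy _ _ _; rewrite adj_minus_connect_sym.
  case/connectP => p0 /shortenP[p yp up _] def_x.
  have sub_adj : subrel e (@adj T) by move=> a b /andP[/andP[]].
  have : ucycle (@adj T) (y :: p).
    by rewrite /ucycle up andbT /= rcons_path -def_x xy andbT (sub_path sub_adj).
  move/tree_acyclic; case: p yp {up} def_x => [_|z [|z' p]] //=.
    by move=> xy0; rewrite xy0 eqxx in nxy.
  by rewrite andbT => /andP[/andP[_ yz] _] xz; rewrite xz !eqxx in yz.
have /connectP[p0 /shortenP[p xp up _] ->] := tree_connected x w.
have [yp|yp] := boolP (y \in x :: p); last by move=> _; apply: path_component.
rewrite inE eq_sym (negPf nxy) /= in yp.
case/splitPr: yp xp up => p1 p2; rewrite cat_path last_cat /= => /and3P[_ _ yp2].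
case/andP=> xp _ /negP[]; apply: path_component => //.
by apply: contraNN xp => xp; rewrite mem_cat xp orbT.
Qed.

Lemma path_ex t t' : exists p, tree_path t t' p.
Proof.
by have /connectP[p0 /shortenP[p tp up _] ->] := tree_connected t t'; exists p.
Qed.

(** If [v] is in [S], the other side of the edge is connected and avoids [v], so it lies in the
    component of [t']. Otherwise [S] itself lies in one component at [v], which contains [t'] or
    not. *)
Lemma component_laminar v t' x y : adj x y -> t' \notin component x y ->
  let S := component x y in let W := ~: component v t' in
  [\/ S \subset W, [disjoint S & W] | W \subset S].
Proof.
move=> xy t'S /=; have [vS|vS] := boolP (v \in component x y).
  constructor 3; rewrite -setCS setCK -(componentC xy).
  by apply: component_sub; rewrite (componentC xy) inE ?vS.
have sub := component_sub vS (mem_component x y).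
have [t'y|t'y] := boolP (t' \in component v y).
  by constructor 2; rewrite disjoints_subset setCK (component_eq t'y).
constructor 1; apply/subsetP => z zS; rewrite inE; apply: contraNN t'y.
by rewrite component_sym (component_eq (subsetP sub z zS)).
Qed.

End TreeFacts.

(** * Joining two copies of a tree by an edge *)

Section Glue.
Variables (T : tree) (a : bool -> T).
Implicit Types (x y z : T * bool) (b c : bool) (u v w : T) (C : {set T}).

(** [a b] is the end in copy [b] of the joining edge. *)
Definition glue_adj : rel (T * bool) := fun x y =>
  if x.2 == y.2 then adj x.1 y.1 else (x.1 == a x.2) && (y.1 == a y.2).

Lemma glue_adj_sym : symmetric glue_adj.
Proof. by move=> x y; rewrite /glue_adj eq_sym adj_sym andbC. Qed.

Lemma glue_adj_irr : irreflexive glue_adj.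
Proof. by move=> x; rewrite /glue_adj eqxx adj_irr. Qed.

Lemma glue_nonempty : (0 < #|{: T * bool}|)%N.
Proof. by rewrite card_prod card_bool muln_gt0 tree_nonempty. Qed.

Lemma connect_map (U V : finType) (e : rel U) (e' : rel V) (f : U -> V) :
  {homo f : x y / e x y >-> e' x y} ->
  {homo f : x y / connect e x y >-> connect e' x y}.
Proof.
move=> h x y /connectP[p xp ->] {y}.
elim: p x xp => [x _|y p IHp x /=]; first exact: connect0.
by case/andP => /h/connect1 xy /IHp; apply: connect_trans.
Qed.

Lemma glue_connected x y : connect glue_adj x y.
Proof.
have copy b u w : connect glue_adj (u, b) (w, b).
  apply: (@connect_map _ _ (@adj T) _ (fun u => (u, b))) (tree_connected u w).
  by move=> u1 u2; rewrite /glue_adj eqxx.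
case: x y => u b [w c]; have [<-|bc] := eqVneq b c; first exact: copy.
apply: connect_trans (copy b u (a b)) (connect_trans _ (copy c (a c) w)).
by apply: connect1; rewrite /glue_adj /= (negPf bc) !eqxx.
Qed.

(** Changing copies means crossing the joining edge, and [(a c, c)] is one of its ends. *)
Lemma glue_path_copy c x p : path glue_adj x p -> (a c, c) \notin x :: p ->
  all (fun z => z.2 == x.2) p.
Proof.
elim: p x => //= y p IHp x /andP[xy yp]; rewrite inE negb_or => /andP[xc ycp].
have eqxy : y.2 = x.2.
  apply/eqP; move: xy; rewrite /glue_adj.
  case: ifP => [/eqP -> //|xy2 /andP[/eqP xa /eqP ya]].
  move: ycp; rewrite inE negb_or => /andP[yc _]; move: xc yc xy2.
  case: x xa {IHp} => x1 x2 /= ->; case: y ya {yp} => y1 y2 /= ->.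
  rewrite !xpair_eqE; case: (eqVneq c x2) => [->|]; first by rewrite eqxx.
  case: (eqVneq c y2) => [->|]; first by rewrite eqxx.
  by case: c x2 y2 => -[] [].
by rewrite eqxy eqxx -eqxy /=; apply: IHp.
Qed.

(** A cycle missing an end of the joining edge stays in one copy and projects to [T]. A cycle
    through both ends splits into two arcs, each confined to a copy; a nonempty arc would have to
    revisit an end in order to leave its copy. *)
Lemma glue_acyclic (s : seq (T * bool)) : ucycle glue_adj s -> (size s <= 2)%N.
Proof.
have proj b q z : path glue_adj z q -> all (fun y => y.2 == b) (z :: q) ->
    path (@adj T) z.1 [seq y.1 | y <- q].
  elim: q z => //= y q IHq z /andP[zy yq] /and3P[/eqP zb yb qb].
  by rewrite IHq ?yb // andbT; move: zy; rewrite /glue_adj zb (eqP yb) eqxx.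
have one_copy c s' : (a c, c) \notin s' -> ucycle glue_adj s' -> (size s' <= 2)%N.
  case: s' => // x p cxp /andP[xp up].
  have xp' : path glue_adj x (rcons p x) := xp.
  have /(glue_path_copy xp') copy : (a c, c) \notin x :: rcons p x.
    by move: cxp; rewrite !inE mem_rcons inE orbA orbb.
  have eqx z : z \in x :: p -> z.2 = x.2.
    move=> zp; have /allP/(_ z) := copy; rewrite mem_rcons => /(_ zp)/eqP //.
  rewrite -(size_map fst); apply: (@tree_acyclic T); apply/andP; split; last first.
    rewrite map_inj_in_uniq // => -[y1 y2] [z1 z2] /eqx /= -> /eqx /= ->.
    by move=> /= ->.
  by rewrite /= -map_rcons; apply: (proj x.2); rewrite //= eqxx.
move=> cs; have [As|] := boolP ((a false, false) \in s); last by move/one_copy/(_ cs).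
have [Bs|] := boolP ((a true, true) \in s); last by move/one_copy/(_ cs).
have [i p def_p] := rot_to As.
rewrite -(size_rot i) def_p.
have {cs} : ucycle glue_adj (rot i s) by rewrite /ucycle rot_cycle rot_uniq.
have {As Bs} : (a true, true) \in rot i s by rewrite mem_rot.
rewrite {i s}def_p inE xpair_eqE andbF /= => Bp /andP[].
case/splitPr: Bp => p1 p2; rewrite /= rcons_cat cat_path /= rcons_path.
case/and4P => Ap1 A1B Bp2 B2A; rewrite mem_cat inE cat_uniq !negb_or /=.
case/and4P => [/and3P[Ap1' _ Ap2']] _ /andP[Bp1 _] /andP[Bp2' _].
have /allP all1 : all (fun z => z.2 == false) p1.
  by apply: (@glue_path_copy true _ _ Ap1); rewrite inE xpair_eqE andbF.
have /allP all2 : all (fun z => z.2 == true) p2.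
  by apply: (@glue_path_copy false _ _ Bp2); rewrite inE xpair_eqE andbF.
have -> : p1 = [::].
  case: p1 Ap1' A1B all1 {Ap1 Bp1} => // y p1 Ap1 A1B all1.
  have /all1 /eqP lf := mem_last y p1.
  move: A1B; rewrite /glue_adj /= lf /= => /andP[/eqP l1 _]; case/negP: Ap1.
  by rewrite (_ : (_, _) = last y p1) ?mem_last // -l1 -lf; case: (last _ _).
have -> // : p2 = [::].
case: p2 Bp2' B2A all2 {Bp2 Ap2'} => // y p2 Bp2 B2A all2.
have /all2 /eqP lf := mem_last y p2.
move: B2A; rewrite /glue_adj /= lf /= => /andP[/eqP l1 _]; case/negP: Bp2.
by rewrite (_ : (_, _) = last y p2) ?mem_last // -l1 -lf; case: (last _ _).
Qed.

Definition glue : tree :=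
  Tree glue_nonempty glue_adj_sym glue_adj_irr glue_connected glue_acyclic.

(** Seen from copy [b], the whole other copy hangs at [a b], so it follows [a b] into or out of
    [C]. *)
Definition glue_lift b C : {set glue} :=
  [set z | if z.2 == b then z.1 \in C else a b \in C].

Definition glue_copy b : {set glue} := [set z | z.2 == b].

Lemma glue_connect_same b v u w : connect (adj_minus v) u w ->
  connect (@adj_minus glue (v, b)) (u, b) (w, b).
Proof.
apply: connect_map (fun u => (u, b)) _ u w => x y /and3P[xv yv xy].
by rewrite /adj_minus /= /glue_adj /= !xpair_eqE !eqxx !andbT xv yv.
Qed.

Lemma glue_connect_other b c v u w : c != b ->
  connect (@adj_minus glue (v, b)) (u, c) (w, c).
Proof.
move=> cb; apply: connect_map (fun u => (u, c)) _ u w (tree_connected u w) => x y xy.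
by rewrite /adj_minus /= /glue_adj /= !xpair_eqE (negPf cb) !andbF eqxx.
Qed.

Lemma glue_bridge b c v : c != b -> v != a b ->
  connect (@adj_minus glue (v, b)) (a b, b) (a c, c).
Proof.
move=> cb vb; apply: connect1; rewrite /adj_minus /= /glue_adj /= !xpair_eqE !eqxx.
by rewrite (negPf cb) (eq_sym b c) (negPf cb) (eq_sym (a b) v) (negPf vb) andbF.
Qed.

Lemma glue_component b v u : u != v ->
  @component glue (v, b) (u, b) = glue_lift b (component v u).
Proof.
move=> uv; have vC := center_notin_component uv.
have cl : closed (@adj_minus glue (v, b)) (mem (glue_lift b (component v u))).
  apply: (@intro_closed glue); first exact: adj_minus_connect_sym.
  move=> [x1 x2] [y1 y2] /and3P[/= xv yv]; rewrite !inE /= /glue_adj /=.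
  case: (eqVneq x2 y2) xv yv => [<-|_] xv yv.
    case: (eqVneq x2 b) xv yv => [->|//]; rewrite !xpair_eqE !eqxx !andbT => xv yv xy ux.
    by apply: connect_trans ux (connect1 _); apply/and3P.
  case/andP => /eqP -> /eqP ->.
  by case: (eqVneq x2 b) => [->|_]; case: (eqVneq y2 b) => [->|_].
apply/setP => -[w c]; rewrite inE; apply/idP/idP => [uw|].
  by rewrite -(closed_connect cl uw) inE /= eqxx mem_component.
rewrite inE /=; have [-> uw|cb ub] := eqVneq c b.
  by rewrite inE in uw; exact: glue_connect_same.
have vb : v != a b by apply: contraNneq vC => {1}->.
rewrite inE in ub; apply: connect_trans (glue_connect_same b ub) _.
exact: connect_trans (glue_bridge cb vb) (glue_connect_other _ _ _ cb).
Qed.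

Lemma glue_component_bridge b v u : v != a b ->
  @component glue (v, b) (u, ~~ b) = glue_lift b (component v (a b)).
Proof.
move=> vb; have nb : ~~ b != b by case: (b).
rewrite -glue_component 1?eq_sym //; apply: component_eq; rewrite inE.
exact: connect_trans (glue_bridge nb vb) (glue_connect_other _ _ _ nb).
Qed.

Lemma glue_component_anchor b u :
  @component glue (a b, b) (u, ~~ b) = glue_copy (~~ b).
Proof.
have nb : ~~ b != b by case: (b).
have cl : closed (@adj_minus glue (a b, b)) (mem (glue_copy (~~ b))).
  apply: (@intro_closed glue); first exact: adj_minus_connect_sym.
  move=> [x1 x2] [y1 y2] /and3P[/= xv yv]; rewrite !inE /= /glue_adj /=.
  case: (eqVneq x2 y2) xv yv => [<- //|ne] xv yv /andP[_ /eqP yb] /eqP xb.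
  have y2b : y2 = b by move: ne; rewrite xb; case: (b) (y2) => -[].
  by rewrite yb y2b eqxx in yv.
apply/setP => -[w c]; rewrite inE; apply/idP/idP => [uw|].
  by rewrite -(closed_connect cl uw) inE.
by rewrite inE => /eqP /= ->; apply: glue_connect_other.
Qed.

Lemma glue_lift_inj b : injective (glue_lift b).
Proof.
move=> C C' /setP eqC; apply/setP => u.
by have := eqC (u, b); rewrite !inE /= eqxx.
Qed.

(** Only at the end of the joining edge does the other copy form a component of its own. *)
Lemma glue_components b v : components ((v, b) : glue) =
  glue_lift b @: components v :|: (if v == a b then [set glue_copy (~~ b)] else set0).
Proof.
apply/setP => C; rewrite inE; apply/imsetP/idP => [[[u c]]|].
  rewrite !inE xpair_eqE; have [-> |cb _] := eqVneq c b.
    rewrite andbT => uv ->; rewrite glue_component //.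
    by apply/orP; left; apply: imset_f; apply: component_in.
  have -> : c = ~~ b by case: c b cb => -[].
  have [->|vb] := eqVneq v (a b).
    by rewrite glue_component_anchor => ->; rewrite inE eqxx orbT.
  rewrite glue_component_bridge // => ->; apply/orP; left.
  by apply: imset_f; apply: component_in; rewrite eq_sym.
case/orP => [/imsetP[_ /imsetP[u uv ->] ->]|].
  exists (u, b); rewrite ?glue_component //; last by rewrite !inE in uv.
  by rewrite !inE xpair_eqE in uv *; rewrite eqxx andbT.
case: eqP => [->|_]; rewrite !inE // => /eqP ->.
exists (a b, ~~ b); rewrite ?glue_component_anchor //.
by rewrite !inE xpair_eqE; case: (b); rewrite andbF.
Qed.

Lemma glue_copy_notin b v : glue_copy (~~ b) \notin glue_lift b @: components v.
Proof.
apply/negP => /imsetP[C Cv /setP eqC].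
have [_ _ [u _ defC]] := componentsP Cv.
have := eqC (u, b); rewrite !inE /= eqxx {1}defC mem_component.
by case: (b).
Qed.

End Glue.

Local Open Scope ring_scope.

(** * Rank deficits *)

Section Deficit.
Variables (E : finType) (M : matroid E).
Implicit Types (A B D W X Y : {set E}).

Lemma rank_mono A B : A \subset B -> (rank M A <= rank M B)%N.
Proof.
move=> sAB; have [I [iI sI <-]] := rank_basis M A.
by apply: rank_indep => //; apply: subset_trans sAB.
Qed.

Lemma rank_set0 : rank M set0 = 0%N.
Proof.
by have [I [_ sI <-]] := rank_basis M set0; apply/eqP; rewrite cards_eq0 -subset0.
Qed.

(** This is the rank of [A] in the contraction of its complement. *)
Definition deficit A : int := (rank M [set: E])%:Z - (rank M (~: A))%:Z.

Lemma connE X : conn M X = (rank M [set: E])%:Z - deficit X - deficit (~: X).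
Proof. rewrite /conn /deficit setCK; lia. Qed.

Lemma connC X : conn M (~: X) = conn M X.
Proof. by rewrite /conn setCK; lia. Qed.

Lemma deficit0 : deficit set0 = 0.
Proof. by rewrite /deficit setC0 subrr. Qed.

Lemma deficitT : deficit [set: E] = (rank M [set: E])%:Z.
Proof. by rewrite /deficit setCT rank_set0 subr0. Qed.

Lemma deficit_mono A B : A \subset B -> deficit A <= deficit B.
Proof. by rewrite -setCS /deficit => /rank_mono; lia. Qed.

Lemma deficit_ge0 A : 0 <= deficit A.
Proof. by rewrite -deficit0 deficit_mono // sub0set. Qed.

Lemma deficit_super A B :
  deficit A + deficit B <= deficit (A :|: B) + deficit (A :&: B).
Proof.
by have := rank_submod M (~: A) (~: B); rewrite -setCU -setCI /deficit; lia.
Qed.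

Lemma conn_submod A B : conn M (A :&: B) + conn M (A :|: B) <= conn M A + conn M B.
Proof.
rewrite !connE setCI setCU.
by have := deficit_super A B; have := deficit_super (~: A) (~: B); lia.
Qed.

Lemma conn_ge0 X : 0 <= conn M X.
Proof.
have := deficit_super X (~: X); rewrite setUCr setICr deficit0 deficitT connE; lia.
Qed.

Lemma conn0 : conn M set0 = 0.
Proof. by rewrite connE setC0 deficit0 deficitT; lia. Qed.

Section Family.
Variables (I : finType) (P : {set I}) (F : I -> {set E}).
Hypothesis disjF : {in P &, forall i j, i != j -> [disjoint F i & F j]}.

Lemma deficit_sum_over A : \sum_(i in P) (deficit (A :|: F i) - deficit A) <=
  deficit (A :|: \bigcup_(i in P) F i) - deficit A.
Proof.
rewrite -!big_enum /=.
have: {subset enum P <= P} by move=> i; rewrite mem_enum.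
elim: (enum P) (enum_uniq (mem P)) => [|i s IHs] /=.
  by rewrite !big_nil setU0 subrr.
case/andP => i_s us sP; rewrite !big_cons; set U := \bigcup_(j <- s) F j.
have {}IHs : \sum_(j <- s) (deficit (A :|: F j) - deficit A) <=
    deficit (A :|: U) - deficit A.
  by apply: IHs => // j js; apply: sP; rewrite inE js orbT.
have dU : F i :&: U = set0.
  apply/setP => x; rewrite !inE; apply/negP => /andP[xi].
  rewrite /U big_seq; elim/big_rec: _ => [|j V js IHV]; first by rewrite inE.
  rewrite inE => /orP[xj|//]; have ij : i != j by apply: contraNneq i_s => ->.
  have := disjF (sP i (mem_head _ _)) (sP j _) ij; rewrite inE js orbT => /(_ isT).
  by rewrite -setI_eq0 => /eqP/setP/(_ x); rewrite !inE xi xj.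
have := deficit_super (A :|: F i) (A :|: U).
rewrite -setUIr dU setU0 setUACA setUid.
by move: IHs; set S := \sum_(j <- s) _; lia.
Qed.

Lemma deficit_sum : \sum_(i in P) deficit (F i) <= deficit (\bigcup_(i in P) F i).
Proof.
have := deficit_sum_over set0; rewrite set0U deficit0 subr0.
by rewrite (eq_bigr (fun i => deficit (F i))) // => i _; rewrite set0U subr0.
Qed.

(* Supermodularity bounds the loss of each [F i] by its gain over [X], the gains
   add up to at most that of [W], and the gain of [D] pays for [~: X]. *)
Lemma deficit_chain W D X : (forall i, i \in P -> F i \subset W) -> [disjoint D & W] ->
  \sum_(i in P) deficit (F i) + deficit D + conn M (X :|: W) <=
  \sum_(i in P) deficit (F i :&: X) + deficit (D :|: ~: X) + conn M X.
Proof.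
move=> FW DW.
have h1 : \sum_(i in P) deficit (F i) - \sum_(i in P) deficit (F i :&: X) <=
    \sum_(i in P) (deficit (X :|: F i) - deficit X).
  rewrite -sumrB; apply: ler_sum => i _.
  by have := deficit_super (F i) X; rewrite (setUC (F i)); lia.
have h2 := deficit_sum_over X.
have h3 : deficit (X :|: \bigcup_(i in P) F i) <= deficit (X :|: W).
  by apply/deficit_mono/setUS/bigcupsP.
have h4 := deficit_super D (~: X).
have h5 : deficit (D :&: ~: X) <= deficit (~: X :&: ~: W).
  by apply: deficit_mono; rewrite setIC setIS // -disjoints_subset.
rewrite !connE setCU; lia.
Qed.

End Family.
End Deficit.

(** * Widths and orders after splitting *)

Section Width.
Variables (E : finType) (M : matroid E) (D : tree_decomposition E).
Notation T := (td_tree D).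
Notation pre := (@td_preim E D).
Notation d := (deficit M).
Implicit Types (s t u v w x y : T) (S C : {set T}) (X Y Z : {set E}).

Lemma td_preimS S C : S \subset C -> pre S \subset pre C.
Proof. by move=> /subsetP sSC; apply/subsetP => e; rewrite !inE => /sSC. Qed.

Lemma td_preimC C : pre (~: C) = ~: pre C.
Proof. by apply/setP => e; rewrite !inE. Qed.

Lemma td_preim_disjoint S C : [disjoint S & C] -> [disjoint pre S & pre C].
Proof. by rewrite !disjoints_subset -td_preimC; apply: td_preimS. Qed.

Lemma components_preim_disjoint v :
  {in components v &, forall C C', C != C' -> [disjoint pre C & pre C']}.
Proof.
by move=> C C' Cv C'v CC'; apply: td_preim_disjoint (components_disjoint Cv C'v CC').
Qed.

Lemma components_preim_disjointD1 v C0 :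
  {in components v :\ C0 &, forall C C', C != C' -> [disjoint pre C & pre C']}.
Proof.
by move=> C C' /setD1P[_ Cv] /setD1P[_ C'v]; apply: components_preim_disjoint Cv C'v.
Qed.

Lemma vertex_widthE v : vertex_width M v =
  (rank M [set: E])%:Z - \sum_(C in components v) d (pre C).
Proof.
rewrite /vertex_width /deficit sumrB sumr_const -mulr_natl natz mulrBl mul1r.
by rewrite !opprB addrCA.
Qed.

(** All parts at [v] lie in [~: Z], so their deficits sum to at most [d (~: Z)]. *)
Lemma rank_le_width v Z : Z \subset pre [set v] -> (rank M Z)%:Z <= vertex_width M v.
Proof.
move=> sZ; rewrite vertex_widthE.
have h1 := deficit_sum M (@components_preim_disjoint v).
have h2 : d (\bigcup_(C in components v) pre C) <= d (~: Z).
  apply/deficit_mono/bigcupsP => C /componentsP[vC _ _].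
  rewrite subsetC; apply: subset_trans sZ _; rewrite -td_preimC.
  by apply: td_preimS; rewrite sub1set inE.
move: h1 h2; rewrite [d (~: Z)]/deficit setCK; set S := \sum_(C in _) _; lia.
Qed.

(** Merging all parts at [v] except the one behind [u] does not lower the total deficit. *)
Lemma conn_le_width v u : adj v u -> conn M (pre (component v u)) <= vertex_width M v.
Proof.
move=> vu; rewrite vertex_widthE connE; set C0 := component v u.
have C0v : C0 \in components v by rewrite component_in // eq_sym adj_neq.
rewrite (big_setD1 _ C0v) /=.
have h1 := deficit_sum M (@components_preim_disjointD1 v C0).
have h2 : d (\bigcup_(C in components v :\ C0) pre C) <= d (~: pre C0).
  apply/deficit_mono/bigcupsP => C /setD1P[CC0 Cv].
  by rewrite -disjoints_subset; apply: (@components_preim_disjoint v).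
move: h1 h2; set S := \sum_(C in _) _; set U := \bigcup_(C in _) _; lia.
Qed.

(* The part of the ground set behind [C] after every element outside [X] has been
   moved to a new leaf attached to [s]. *)
Definition push s X C : {set E} :=
  if s \in C then pre C :|: ~: X else pre C :&: X.

(** The width of [v] in the tree with the new leaf; at [v = s] the leaf is an additional component,
    carrying [~: X]. *)
Definition push_width s X v : int :=
  (rank M [set: E])%:Z - \sum_(C in components v) d (push s X C)
    - (if v == s then d (~: X) else 0).

Lemma push_setC s X C : push s X (~: C) = ~: push s X C.
Proof.
rewrite /push inE; case: (s \in C) => /=; rewrite td_preimC ?setCU ?setCI ?setCK //.
Qed.

(** In [deficit_chain], the role of [D] falls to the part containing [s], which gains [~: X], and
    the other parts lie in [W]. At [v = s] there is no such part: [D] is empty and the leaf takes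
    its place. *)
Lemma push_width_chain s X v :
  push_width s X v + conn M (X :|: pre (~: component v s)) <= vertex_width M v + conn M X.
Proof.
rewrite vertex_widthE /push_width; have [vs|vs] := eqVneq v s.
  have sub C : C \in components v -> pre C \subset pre (~: component v s).
    case/componentsP=> vC _ _; apply: td_preimS; rewrite -vs component_center.
    by rewrite subsetC sub1set inE.
  have disj : [disjoint set0 & pre (~: component v s)] by rewrite -setI_eq0 set0I.
  have := deficit_chain M (@components_preim_disjoint v) X sub disj.
  have <- : \sum_(C in components v) d (push s X C) =
      \sum_(C in components v) d (pre C :&: X).
    by apply: eq_bigr => C /componentsP[vC _ _]; rewrite /push -vs (negPf vC).
  rewrite set0U deficit0.
  by set S := \sum_(C in _) _; set S' := \sum_(C in _) _; lia.
set C0 := component v s.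
have C0v : C0 \in components v by rewrite component_in // eq_sym.
have sC0 : s \in C0 by apply: mem_component.
rewrite !(big_setD1 _ C0v) /=.
have -> : \sum_(C in components v :\ C0) d (push s X C) =
    \sum_(C in components v :\ C0) d (pre C :&: X).
  apply: eq_bigr => C /setD1P[CC0 /componentsP[_ defC _]]; rewrite /push.
  by case: ifP => // /defC eqC; rewrite eqC eqxx in CC0.
rewrite {1}/push sC0.
have hd : [disjoint pre C0 & pre (~: C0)].
  by rewrite disjoints_subset td_preimC setCK.
have hs C : C \in components v :\ C0 -> pre C \subset pre (~: C0).
  case/setD1P => CC0 Cv; rewrite td_preimC -disjoints_subset.
  exact: (@components_preim_disjoint v).
have := deficit_chain M (@components_preim_disjointD1 v C0) X hs hd.
by set S := \sum_(C in _) _; set S' := \sum_(C in _) _; lia.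
Qed.

Lemma sum_components_mem v t (a : int) :
  \sum_(C in components v) (if t \in C then a else 0) = if v == t then 0 else a.
Proof.
have [<-|vt] := eqVneq v t.
  by rewrite big1 // => C /componentsP[/negPf ->].
have C0v : component v t \in components v by rewrite component_in // eq_sym.
rewrite (big_setD1 _ C0v) /= mem_component big1 ?addr0 // => C.
case/setD1P => CC0 /componentsP[_ defC _].
by case: ifP => // /defC eqC; rewrite eqC eqxx in CC0.
Qed.

(** Each of [d X] and [d (~: X)] is gained once: by supermodularity at the part containing [t] or
    [t'], or from the leaf if [v] is that vertex. An uncrossed part survives whole in one of the
    copies. *)
Lemma push_width_sum t t' X v :
  (forall C, C \in components v -> t \in C -> t' \notin C) ->
  (forall C, C \in components v -> t \notin C -> t' \notin C ->
    (pre C \subset X) || (pre C \subset ~: X)) ->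
  push_width t' X v + push_width t (~: X) v <= vertex_width M v + conn M X.
Proof.
move=> sep_tt' unc; rewrite vertex_widthE connE /push_width setCK.
suff : \sum_(C in components v) (d (pre C) + (if t \in C then d X else 0)
        + (if t' \in C then d (~: X) else 0)) <=
    \sum_(C in components v) (d (push t' X C) + d (push t (~: X) C)).
  by rewrite !big_split /= !sum_components_mem; do 2 case: ifP => _; lia.
apply: ler_sum => C Cv; rewrite /push setCK; case: (boolP (t \in C)) => tC.
  by rewrite (negPf (sep_tt' _ Cv tC)); have := deficit_super M (pre C) X; lia.
case: (boolP (t' \in C)) => t'C.
  by have := deficit_super M (pre C) (~: X); lia.
case/orP: (unc _ Cv tC t'C) => /setIidPl ->.
  by have := deficit_ge0 M (pre C :&: ~: X); lia.
by have := deficit_ge0 M (pre C :&: X); lia.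
Qed.

Lemma push_width_le0 s X v C : C \in components v -> push s X C = [set: E] ->
  push_width s X v <= 0.
Proof.
move=> Cv pC; rewrite /push_width (big_setD1 _ Cv) /= pC deficitT.
have : 0 <= \sum_(C' in components v :\ C) d (push s X C').
  by apply: sumr_ge0 => C' _; apply: deficit_ge0.
by set S := \sum_(C' in _) _; case: ifP => _; have := deficit_ge0 M (~: X); lia.
Qed.

End Width.

(** * The choice of the separation *)

Section Best.
Variables (E : finType) (M : matroid E) (D : tree_decomposition E).
Notation T := (td_tree D).
Notation pre := (@td_preim E D).
Implicit Types (s t u v w x y : T) (e : T * T) (S C : {set T}) (X Y Z : {set E}).

Definition separates (Z1 Z2 X : {set E}) := (Z1 \subset X) && (Z2 \subset ~: X).

(** An ordered edge stands for the side behind its second vertex; this side is turned away from the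
    path from [t] to [t']. *)
Definition off_edge t t' e : bool :=
  [&& adj e.1 e.2, t \notin component e.1 e.2 & t' \notin component e.1 e.2].

Definition uncrossed X e : bool :=
  (pre (component e.1 e.2) \subset X) || (pre (component e.1 e.2) \subset ~: X).

(** Crossing as few sides as possible is expressed as leaving as many as possible uncrossed. *)
Definition best t t' Z1 Z2 X : Prop :=
  [/\ separates Z1 Z2 X,
      forall Y, separates Z1 Z2 Y -> conn M X <= conn M Y &
      forall Y, separates Z1 Z2 Y -> conn M Y = conn M X ->
        (#|[set e | off_edge t t' e && uncrossed Y e]| <=
         #|[set e | off_edge t t' e && uncrossed X e]|)%N].

Lemma separatesC Z1 Z2 X : separates Z2 Z1 (~: X) = separates Z1 Z2 X.
Proof. by rewrite /separates setCK andbC. Qed.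

(** This symmetry carries every fact about the first copy over to the second. *)
Lemma best_sym t t' Z1 Z2 X : best t t' Z1 Z2 X -> best t' t Z2 Z1 (~: X).
Proof.
have eq_score Y : [set e | off_edge t' t e && uncrossed (~: Y) e] =
    [set e | off_edge t t' e && uncrossed Y e].
  apply/setP => e; rewrite !inE /off_edge /uncrossed setCK orbC.
  by rewrite [(t' \notin _) && _]andbC.
case=> sX minX maxX; split=> [|Y|Y]; first by rewrite separatesC.
  by rewrite -{1}(setCK Y) separatesC connC -(connC M Y) => /minX.
rewrite -{1}(setCK Y) separatesC !connC => sY eqY.
by rewrite eq_score -{1}(setCK Y) eq_score; apply: maxX => //; rewrite connC.
Qed.

Lemma best_ex t t' Z1 Z2 X0 : separates Z1 Z2 X0 ->
  exists2 X, best t t' Z1 Z2 X & conn M X <= conn M X0.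
Proof.
move=> sX0; have [X sX minX] := arg_minnP (fun X => `|conn M X|%N) sX0.
have min_conn Y : separates Z1 Z2 Y -> conn M X <= conn M Y.
  by move=> /minX; have := conn_ge0 M X; have := conn_ge0 M Y; lia.
have PX : separates Z1 Z2 X && (conn M X == conn M X) by rewrite sX eqxx.
have [Y /andP[sY /eqP eqY] maxY] :=
  @arg_maxnP _ X (fun Y => separates Z1 Z2 Y && (conn M Y == conn M X))
    (fun Y => #|[set e | off_edge t t' e && uncrossed Y e]|) PX.
exists Y; last by rewrite eqY min_conn.
split=> // [V|V sV eqV]; rewrite ?eqY; first exact: min_conn.
by apply: maxY; rewrite sV eqV eqY eqxx.
Qed.

Section BestFacts.
Variables (t t' : T) (Z1 Z2 X : {set E}).
Hypothesis Z2t' : Z2 \subset pre [set t'].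
Hypothesis bestX : best t t' Z1 Z2 X.

Lemma separatesU S : t' \notin S -> separates Z1 Z2 (X :|: pre S).
Proof.
move=> t'S; have [/andP[sZ1 sZ2] _ _] := bestX; apply/andP; split.
  exact: subset_trans sZ1 (subsetUl _ _).
rewrite setCU subsetI sZ2 -td_preimC; apply: subset_trans Z2t' _.
by apply: td_preimS; rewrite sub1set inE.
Qed.

Lemma best_connU S : t' \notin S -> conn M X <= conn M (X :|: pre S).
Proof. by move=> /separatesU; have [_ minX _] := bestX => /minX. Qed.

(* Otherwise [X :|: pre (~: component v t')] would be a minimizer crossing fewer
   off-path edges. *)
Lemma best_uncrossed v x y : let W := ~: component v t' in
  conn M (X :|: pre W) <= conn M X -> off_edge t t' (x, y) ->
  component x y \subset W -> uncrossed X (x, y).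
Proof.
move=> W leW off_xy sub_xy; apply: contraT => cross_xy.
have t'W : t' \notin W by rewrite !inE negbK connect0.
have [_ _ maxX] := bestX.
have eqW : conn M (X :|: pre W) = conn M X.
  by apply/eqP; rewrite eq_le leW best_connU.
have := maxX _ (separatesU t'W) eqW; rewrite leqNgt => /negP[].
apply: proper_card; apply/properP; split; last first.
  exists (x, y); rewrite inE off_xy ?(negPf cross_xy) //=.
  by apply/orP; left; apply: subsetU; rewrite td_preimS ?orbT.
apply/subsetP => -[x' y']; rewrite !inE => /andP[off' unc']; rewrite off' /=.
case/orP: unc' => [sub|sub].
  by apply/orP; left; apply: subset_trans sub (subsetUl _ _).
(* A side inside [~: X] could become crossed only if it contained [W]; but then [component x y]
   would be inside [~: X] too. *)
have /and3P[adj' _ t'C] := off'; have [sW|dW|Ws] := component_laminar v adj' t'C.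
- by apply/orP; left; apply: subsetU; rewrite td_preimS ?orbT.
- apply/orP; right; rewrite setCU subsetI sub -td_preimC td_preimS //.
  by rewrite -disjoints_subset.
- case/orP: cross_xy; right; apply: subset_trans sub.
  by apply: td_preimS; apply: subset_trans sub_xy Ws.
Qed.

(** The chain inequality loses nothing, as [X] has minimal connectivity among the separating
    sets. *)
Lemma push_width_le v : push_width M t' X v <= vertex_width M v.
Proof.
have t'W : t' \notin ~: component v t' by rewrite !inE negbK connect0.
by have := push_width_chain M t' X v; have := best_connU t'W; lia.
Qed.

(** Equality makes [X :|: pre W] another minimizer, so off-path sides within [W] are uncrossed. If a
    part contains both [t] and [t'], its complement is such a side, and the part grows to all of [E]
    in one copy. Otherwise [push_width_sum] applies. *)
Lemma push_width_tight v : push_width M t' X v = vertex_width M v ->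
  push_width M t' X v <= conn M X \/ push_width M t (~: X) v <= conn M X.
Proof.
move=> tight; have leW : conn M (X :|: pre (~: component v t')) <= conn M X.
  by have := push_width_chain M t' X v; lia.
have X0 := conn_ge0 M X.
have [/existsP[C /and3P[Cv tC t'C]]|on] :=
  boolP [exists C, [&& C \in components v, t \in C & t' \in C]].
  have [vC defC [x vx defCx]] := componentsP Cv.
  have eqC : component x v = ~: C by rewrite defCx componentC.
  have off : off_edge t t' (x, v) by rewrite /off_edge /= adj_sym vx eqC !inE tC t'C.
  have : uncrossed X (x, v).
    by apply: (@best_uncrossed v) => //; rewrite eqC (defC _ t'C).
  rewrite /uncrossed /= eqC td_preimC => /orP[] sub; [right|left];
    apply: le_trans X0; apply: (@push_width_le0 _ _ _ _ _ _ C) => //.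
    rewrite /push tC setCK; apply/setP => e; rewrite !inE -implyNb.
    by apply/implyP => eC; apply: (subsetP sub); rewrite !inE.
  rewrite /push t'C; apply/setP => e; rewrite !inE -implyNb; apply/implyP => /= eC.
  by have /subsetP/(_ e) := sub; rewrite !inE => ->.
right; have := @push_width_sum _ M _ t t' X v; rewrite tight => h.
suff: vertex_width M v + push_width M t (~: X) v <= vertex_width M v + conn M X by lia.
apply: h => [C Cv tC|C Cv tC t'C].
  by apply: contraNN on => t'C; apply/existsP; exists C; rewrite Cv tC.
have [vC defC [u vu defCu]] := componentsP Cv.
have : uncrossed X (v, u).
  apply: (@best_uncrossed v) => //; first by rewrite /off_edge /= vu -defCu tC.
  rewrite -defCu; apply/subsetP => w /defC eqC; rewrite inE.
  by apply: contraNN t'C; rewrite eqC component_sym.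
by rewrite /uncrossed /= -defCu.
Qed.

(** Up to complement [t'] is not in [C]; then this is submodularity and minimality of [conn M X]. *)
Lemma conn_push_le C : conn M (push t' X C) <= conn M (pre C).
Proof.
wlog t'C : C / t' \notin C => [hw|].
  have [/hw//|] := boolP (t' \notin C); rewrite negbK => t'C.
  by have := hw (~: C); rewrite inE t'C push_setC td_preimC !connC; apply.
rewrite /push (negPf t'C).
have := conn_submod M (pre C) X; have := best_connU t'C.
by rewrite (setUC X); lia.
Qed.

(** Equality again gives a second minimizer [X :|: pre C]. If [t] is in [C], this set is the side of
    the edge in the other copy; if not, [C] is uncrossed and one copy of it is empty. *)
Lemma conn_push_tight x y : adj x y ->
  let C := component x y in conn M (push t' X C) = conn M (pre C) ->
  conn M (push t' X C) <= conn M X \/ conn M (push t (~: X) C) <= conn M X.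
Proof.
wlog t'C : x y / t' \notin component x y => [hw xy /=|xy /=].
  have [t'C|] := boolP (t' \notin component x y); first exact: hw.
  rewrite negbK => t'C; have := hw y x; rewrite adj_sym (componentC xy) inE t'C.
  by rewrite /= !push_setC td_preimC !connC; apply.
set C := component x y in t'C *.
have X0 := conn_ge0 M X.
have eqC : C = ~: component y t'.
  rewrite (@component_eq _ y x t') ?(componentC xy) ?setCK // inE //.
have := conn_submod M (pre C) X; rewrite /push (negPf t'C) setCK => sub tight.
have leW : conn M (X :|: pre C) <= conn M X by rewrite setUC; lia.
case: ifP => tC; first by right; rewrite setUC.
have : uncrossed X (x, y).
  by apply: (@best_uncrossed y); rewrite -?eqC // /off_edge /= xy tC.
rewrite /uncrossed /= -/C => /orP[sub1|sub1]; [right|left].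
  rewrite (_ : _ :&: _ = set0) ?conn0 //; apply/eqP.
  by rewrite setI_eq0 disjoints_subset setCK.
by rewrite (_ : _ :&: _ = set0) ?conn0 //; apply/eqP; rewrite setI_eq0 disjoints_subset.
Qed.

End BestFacts.
End Best.

(** * The split decomposition *)

Section Split.
Variables (E : finType) (M : matroid E) (D : tree_decomposition E).
Variables (t t' : td_tree D) (X : {set E}).
Implicit Types (b : bool) (v x y : td_tree D) (C : {set td_tree D}).

Definition anchor b : td_tree D := if b then t else t'.

Definition side b : {set E} := if b then ~: X else X.

(* The copy carrying [X] is joined at [t'], the end where the other set lives, and
   conversely. *)
Definition split_td : tree_decomposition E :=
  @TreeDecomposition E (glue anchor) (fun e => (td_map D e, e \notin X)).

Lemma mem_side b e : (e \in side b) = ((e \notin X) == b).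
Proof. by case: b; rewrite /side ?inE; case: (e \in X). Qed.

Lemma sideC b : ~: side b = side (~~ b).
Proof. by case: b; rewrite /side ?setCK. Qed.

Lemma split_preim_lift b C :
  @td_preim E split_td (glue_lift anchor b C) = push (anchor b) (side b) C.
Proof.
apply/setP => e; rewrite inE [X in X = _]inE /= /push.
by case: ifP => sb; case: ifP => aC; rewrite !inE mem_side sb ?andbT ?andbF ?orbF ?orbT.
Qed.

Lemma split_preim_copy b : @td_preim E split_td (glue_copy anchor b) = side b.
Proof. by apply/setP => e; rewrite !inE mem_side. Qed.

Lemma split_width b v :
  @vertex_width E M split_td (v, b) = push_width M (anchor b) (side b) v.
Proof.
have sum_lift : \sum_(C in glue_lift anchor b @: components v)
      deficit M (@td_preim E split_td C) =
    \sum_(C in components v) deficit M (push (anchor b) (side b) C).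
  rewrite big_imset; last by move=> C C' _ _; apply: glue_lift_inj.
  by apply: eq_bigr => C _; rewrite split_preim_lift.
rewrite vertex_widthE /push_width glue_components; case: ifP => _.
  rewrite setUC big_setU1 ?glue_copy_notin //= sum_lift split_preim_copy sideC.
  by rewrite opprD addrA addrAC.
by rewrite setU0 sum_lift subr0.
Qed.

Lemma split_component b x y : adj x y -> @td_preim E split_td
  (@component (glue anchor) (x, b) (y, b)) = push (anchor b) (side b) (component x y).
Proof. by move=> xy; rewrite glue_component ?split_preim_lift // eq_sym adj_neq. Qed.

End Split.

(** * Level counts and their lexicographic comparison *)

Section Level.
Variable E : finType.
Variable M : matroid E.

Definition node (D : tree_decomposition E) : finType :=
  (td_tree D + td_tree D * td_tree D)%type.

(** Each edge is counted in both orientations, with equal weight; the value 0 for non-adjacent pairs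
    is below the levels [p >= k > 0] at which decompositions are compared. *)
Definition node_weight (D : tree_decomposition E) (z : node D) : int :=
  match z with
  | inl v => vertex_width M v
  | inr (x, y) => if adj x y then conn M (td_preim (component x y)) else 0
  end.

Definition level (I : finType) (f : I -> int) (p : nat) := #|[set z | p%:Z <= f z]|.

(** The level [q] is the largest weight of an element of weight at least [k] that shrinks in both
    copies. From [q] upwards no element counts in both copies, since it would shrink in both and be
    heavier than [q]. At [q] itself the element attaining it is lost. *)
Lemma level_drop (I I' : finType) (f : I -> int) (f' : I' -> int)
    (lift : bool -> I -> I') (k : nat) :
  (forall z, k%:Z <= f' z -> exists b x, z = lift b x) ->
  (forall b x, f' (lift b x) <= f x) ->
  (forall x, k%:Z <= f x -> (forall b, f' (lift b x) < f x) \/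
     exists b, f' (lift b x) < k%:Z) ->
  (exists2 x, k%:Z <= f x & forall b, f' (lift b x) < f x) ->
  exists2 q, (level f' q < level f q)%N &
    forall p, (q < p)%N -> (level f' p <= level f p)%N.
Proof.
move=> onto le_f tri [x1 kx1 lt1].
pose P x := [&& k%:Z <= f x, f' (lift true x) < f x & f' (lift false x) < f x].
have Px1 : P x1 by rewrite /P kx1 !lt1.
have [x0 /and3P[kx0 lt_t lt_f] max_x0] := @arg_maxnP _ x1 P (fun x => `|f x|%N) Px1.
pose A b p := [set x | p%:Z <= f' (lift b x)].
have leA p : (k <= p)%N -> (level f' p <= #|A false p| + #|A true p|)%N.
  move=> kp; pose B := lift false @: A false p :|: lift true @: A true p.
  apply: (@leq_trans #|B|).
    apply/subset_leq_card/subsetP => z; rewrite inE => pz.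
    have [|b [x def_z]] := onto z; first by apply: le_trans pz; rewrite lez_nat.
    have xA : x \in A b p by rewrite inE -def_z.
    by rewrite inE def_z; case: b {def_z} xA => xA; rewrite (imset_f _ xA) ?orbT.
  apply: leq_trans (leq_card_setU _ _) _.
  by apply: leq_add; apply: leq_imset_card.
have subA b p : A b p \subset [set x | p%:Z <= f x].
  by apply/subsetP => x; rewrite !inE => /le_trans; apply.
have disjA p : (`|f x0| <= p)%N -> A false p :&: A true p = set0.
  move=> qp; apply/setP => x; rewrite !inE; apply/negP => /andP[pf pt].
  have kx : k%:Z <= f x by have := le_f true x; lia.
  have [lt|[b ltb]] := tri x kx; last by case: b ltb; lia.
  have Px : P x by rewrite /P kx !lt.
  by have /= := max_x0 x Px; have := lt true; lia.
have cardA p : (`|f x0| <= p)%N -> (level f' p <= #|A false p :|: A true p|)%N.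
  move=> qp; apply: leq_trans (leA p _) _; first by lia.
  by rewrite -cardsUI disjA // cards0 addn0.
exists `|f x0|%N.
  apply: leq_ltn_trans (cardA _ _) _ => //; apply: proper_card; apply/properP; split.
    by rewrite subUset !subA.
  by exists x0; rewrite !inE; lia.
move=> p qp; apply: leq_trans (cardA _ _) _; first exact: ltnW.
by apply: subset_leq_card; rewrite subUset !subA.
Qed.

(** Coordinates are treated one at a time: among the members agreeing with [u] on the first [n], the
    next one is minimized. *)
Lemma lex_min (U : Type) (P : U -> Prop) (c : U -> nat -> nat) (n : nat) :
  (exists u, P u) -> exists2 u, P u & forall u', P u' -> forall i, (i < n)%N ->
    (forall j, (j < i)%N -> (c u' j <= c u j)%N) -> (c u i <= c u' i)%N.
Proof.
move=> exP; elim: n => [|n [u Pu min_u]]; first by case: exP => u; exists u.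
pose Q u' := P u' /\ forall i, (i < n)%N -> c u' i = c u i.
have exm : exists m, `[< exists2 u', Q u' & c u' n = m >].
  by exists (c u n); apply/asboolP; exists u.
case: (ex_minnP exm) => m /asboolP[v [Pv eqv] cv] min_m; exists v => // u' Pu' i.
rewrite ltnS leq_eqVlt => /orP[/eqP ->|lt_in] le_u'.
  rewrite cv; apply: min_m; apply/asboolP; exists u' => //; split=> // h.
  (* A competitor nowhere larger on the first [n] coordinates agrees there by minimality of [u], so
     it satisfies [Q]. *)
  elim/ltn_ind: h => h IHh lt_hn; apply/eqP; rewrite eqn_leq -{1}(eqv _ lt_hn) le_u' //=.
  by apply: min_u => // j jh; rewrite IHh //; apply: ltn_trans lt_hn.
rewrite eqv //; apply: min_u => // j ji.
by rewrite -eqv ?le_u' //; apply: ltn_trans lt_in.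
Qed.

Lemma path_transition (U : eqType) (Q : pred U) (e : rel U) t p : path e t p -> Q t ->
  ~~ Q (last t p) -> exists u v, [/\ infix [:: u; v] (t :: p), e u v, Q u & ~~ Q v].
Proof.
elim: p t => [|y p IHp] t /=; first by move=> _ ->.
case/andP=> ty yp Qt nQ; have [Qy|nQy] := boolP (Q y).
  have [u [v [uv euv Qu Qv]]] := IHp y yp Qy nQ; exists u, v; split=> //.
  by apply: infix_trans uv (infix_cons _ _).
by exists t, y; split=> //; rewrite /= !eqxx prefix0s.
Qed.

End Level.

Lemma conn2_lt (E : finType) (M : matroid E) (k : nat) (Z1 Z2 : {set E}) :
  ~~ (k%:Z%:E <= conn2 M Z1 Z2)%E -> exists2 X, separates Z1 Z2 X & conn M X < k%:Z.
Proof.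
move=> nle; have [/existsP[X /andP[sX ltX]]|none] :=
  boolP [exists X, separates Z1 Z2 X && (conn M X < k%:Z)]; first by exists X.
case/negP: nle; apply/bigmin_geP; split=> [|X sX]; first exact: leey.
rewrite lee_fin leNgt; apply: contraNN none => ltX.
by apply/existsP; exists X; rewrite ltX andbT.
Qed.

(** * Splitting at a failure of leanness lowers the level counts *)

Section Improve.
Variables (E : finType) (M : matroid E) (D : tree_decomposition E).
Variables (k : nat) (t t' : td_tree D) (Z1 Z2 X : {set E}).
Hypotheses (Z1t : Z1 \subset td_preim [set t]) (Z2t' : Z2 \subset td_preim [set t']).
Hypotheses (rZ1 : rank M Z1 = k) (rZ2 : rank M Z2 = k).
Hypotheses (bestX : best M t t' Z1 Z2 X) (ltX : conn M X < k%:Z).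
Hypothesis large : forall s s', edge_on_path t t' s s' ->
  k%:Z <= conn M (td_preim (component s' s)).

Let D' := split_td t t' X.
Let bestX' := best_sym bestX.

Lemma split_width_le b v : @vertex_width E M D' (v, b) <= vertex_width M v.
Proof.
rewrite split_width; case: b; rewrite /anchor /side.
  exact: (push_width_le Z1t bestX').
exact: (push_width_le Z2t' bestX).
Qed.

Lemma split_width_tri v : (forall b, @vertex_width E M D' (v, b) < vertex_width M v) \/
  exists b, @vertex_width E M D' (v, b) <= conn M X.
Proof.
have [/existsP[b tight]|] :=
    boolP [exists b, vertex_width M v <= @vertex_width E M D' (v, b)].
  right; have {tight} := conj (split_width_le b v) tight => /andP/le_anti.
  case: b; rewrite split_width /anchor /side => tight.
    have := push_width_tight Z1t bestX' tight; rewrite setCK connC.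
    by case; [exists true|exists false]; rewrite split_width.
  have := push_width_tight Z2t' bestX tight.
  by case; [exists false|exists true]; rewrite split_width.
by move=> /existsPn lt; left=> b; rewrite ltNge.
Qed.

Definition split_node b (z : node D) : node D' :=
  match z with inl v => inl (v, b) | inr (x, y) => inr ((x, b), (y, b)) end.

Lemma split_adj b x y : @adj (td_tree D') (x, b) (y, b) = adj x y.
Proof. by rewrite /= /glue_adj eqxx. Qed.

Lemma split_node_le b z : node_weight M (split_node b z) <= node_weight M z.
Proof.
case: z => [v|[x y]]; first exact: split_width_le.
rewrite /node_weight /split_node split_adj; case: ifP => // xy.
rewrite split_component //; case: b; rewrite /anchor /side.
  exact: (conn_push_le Z1t bestX').
exact: (conn_push_le Z2t' bestX).
Qed.

Lemma split_node_tri z : (forall b, node_weight M (split_node b z) < node_weight M z) \/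
  exists b, node_weight M (split_node b z) <= conn M X.
Proof.
case: z => [v|[x y]]; first exact: split_width_tri.
rewrite /node_weight /split_node; have [xy|xy] := boolP (adj x y); last first.
  by right; exists true; rewrite split_adj (negPf xy) conn_ge0.
have [/existsP[b tight]|] := boolP [exists b,
    node_weight M (inr (x, y) : node D) <= node_weight M (split_node b (inr (x, y)))].
  right; have {tight} := conj (split_node_le b (inr (x, y))) tight => /andP/le_anti.
  rewrite /node_weight /split_node split_adj xy split_component //.
  case: b; rewrite /anchor /side => tight.
    have := conn_push_tight Z1t bestX' xy tight; rewrite setCK connC.
    by case; [exists true|exists false]; rewrite split_adj xy split_component.
  have := conn_push_tight Z2t' bestX xy tight.
  by case; [exists false|exists true]; rewrite split_adj xy split_component.
by move=> /existsPn lt; left=> b; rewrite ltNge; have := lt b; rewrite /= xy.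
Qed.

(** Only the joining edge and non-adjacent pairs across the copies are not lifted; their weights are
    [conn M X] and 0, both below [k]. *)
Lemma split_node_onto (z : node D') : k%:Z <= node_weight M z ->
  exists b x, z = split_node b x.
Proof.
have X0 := conn_ge0 M X.
case: z => [[v b]|[[x b] [y c]]]; first by exists b, (inl v).
have [<- _|bc] := eqVneq b c; first by exists b, (inr (x, y)).
rewrite /node_weight; case: ifP => [|_ kle]; last by lia.
have -> : c = ~~ b by case: b c bc => -[].
rewrite /= {1}/glue_adj /=; have /negPf -> : b != ~~ b by case: (b).
case/andP=> /eqP -> /eqP ->.
rewrite glue_component_anchor split_preim_copy.
have -> : conn M (side X (~~ b)) = conn M X by case: (b); rewrite /side ?connC.
lia.
Qed.

Lemma split_rank b (Z : {set E}) (v : td_tree D) :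
  Z \subset td_preim [set v] -> Z \subset side X b ->
  (rank M Z)%:Z <= @vertex_width E M D' (v, b).
Proof.
move=> /subsetP Zv /subsetP Zs; apply: rank_le_width; apply/subsetP => e eZ.
have := Zv e eZ; have := Zs e eZ; rewrite mem_side !inE xpair_eqE.
by move=> -> ->.
Qed.

(* If no vertex shrinks in both copies, then each vertex of the path is small in
   one copy; where the small copy changes, the edge between shrinks in both. *)
Lemma split_node_strict : exists2 z, k%:Z <= node_weight M z &
  forall b, node_weight M (split_node b z) < node_weight M z.
Proof.
apply: contrapT => none; have [/andP[Z1X Z2X] _ _] := bestX.
have small v : k%:Z <= vertex_width M v ->
    exists b, @vertex_width E M D' (v, b) <= conn M X.
  move=> kv; have [lt|//] := split_width_tri v.
  by case: none; exists (inl v).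
have t1 : k%:Z <= @vertex_width E M D' (t, false) by rewrite -rZ1 split_rank.
have t2 : k%:Z <= @vertex_width E M D' (t', true) by rewrite -rZ2 split_rank.
(* [Z1] stays at [t] in copy [false] and [Z2] at [t'] in copy [true], so these keep width at least
   [k]: hence [Q] holds at [t] and fails at [t']. *)
pose Q v := @vertex_width E M D' (v, true) <= conn M X.
have [p [tp up def_t']] := path_ex t t'.
have Qt : Q t.
  have [|b leb] := small t; first exact: le_trans t1 (split_width_le false t).
  by case: b leb => // /(le_trans t1); rewrite leNgt ltX.
have nQt' : ~~ Q (last t p) by rewrite def_t' /Q -ltNge; apply: lt_le_trans t2.
have [u [v [uv_p uv Qu nQv]]] := path_transition tp Qt nQt'.
have k_uv : k%:Z <= conn M (td_preim (component v u)) by apply: large; exists p.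
have vu : adj v u by rewrite adj_sym.
have Qv : @vertex_width E M D' (v, false) <= conn M X.
  have [|[] //] := small v; first exact: le_trans k_uv (conn_le_width M vu).
  by move/negP: nQv.
case: none; exists (inr (v, u)); rewrite /node_weight /split_node vu // => b.
rewrite split_adj vu; have vu' : @adj (td_tree D') (v, b) (u, b) by rewrite split_adj.
(* Both copies of the edge have a small end: [v] in copy [false] and [u] in copy [true]. *)
suff : conn M (@td_preim E D' (@component (td_tree D') (v, b) (u, b))) <= conn M X.
  by move=> /le_lt_trans; apply; apply: lt_le_trans k_uv.
case: b vu' => vu'; last exact: le_trans (conn_le_width M vu') Qv.
have uv' : @adj (td_tree D') (u, true) (v, true) by rewrite split_adj.
rewrite (componentC uv') td_preimC connC.
exact: le_trans (conn_le_width M uv') Qu.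
Qed.

Lemma split_improves : exists2 q,
  (level (@node_weight E M D') q < level (@node_weight E M D) q)%N &
  forall p, (q < p)%N ->
    (level (@node_weight E M D') p <= level (@node_weight E M D) p)%N.
Proof.
apply: (@level_drop _ _ _ _ split_node k).
- exact: split_node_onto.
- exact: split_node_le.
- move=> z _; have [lt|[b le]] := split_node_tri z; first by left.
  by right; exists b; apply: le_lt_trans ltX.
- exact: split_node_strict.
Qed.

End Improve.

Theorem theorem5p14 (E : finType) (M : matroid E) :
  exists D : tree_decomposition E, lean M D /\ width M D = Posz (tw M).
Proof.
have [[D0 eqD0] tw_min] := twP M.
pose P (D : tree_decomposition E) := forall v : td_tree D, vertex_width M v <= (tw M)%:Z.
have exP : exists D, P D.
  by exists D0 => v; rewrite -eqD0; apply: (widthP M D0).1.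
(* Coordinate [i] is the level count at [tw M - i], so levels are read downwards from [tw M] to
   0. *)
have [D PD minD] :=
  lex_min (fun D i => level (@node_weight E M D) (tw M - i)) (tw M).+1 exP.
exists D; split; last first.
  apply/eqP; rewrite eq_le tw_min andbT; apply/bigmax_leP; split=> // v _; exact: PD.
move=> k t t' Z1 Z2 Z1t Z2t' rZ1 rZ2.
have [|/conn2_lt[X0 sX0 ltX0]] := boolP (k%:Z%:E <= conn2 M Z1 Z2)%E; first by left.
right; apply: contrapT => none.
have [X bestX leX] := best_ex M t t' sX0.
have ltX := le_lt_trans leX ltX0.
have large s s' : edge_on_path t t' s s' -> k%:Z <= conn M (td_preim (component s' s)).
  by move=> ss'; rewrite leNgt; apply/negP => lt; apply: none; exists s, s'.
have [q ltq leq_q] := split_improves Z1t Z2t' rZ1 rZ2 bestX ltX large.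
(* Some vertex or edge of [D] reaches level [q], and edge orders are bounded by vertex widths; hence
   [q] is among the coordinates compared. *)
have qtw : (q <= tw M)%N.
  have /card_gt0P[z] : (0 < level (@node_weight E M D) q)%N by apply: leq_trans ltq.
  rewrite inE; case: z => [v|[x y]] /=; first by have := PD v; lia.
  by case: ifP => [/(conn_le_width M)|_]; have := PD x; lia.
have PD' : P (split_td t t' X).
  by case=> v b; apply: le_trans (PD v); apply: split_width_le Z1t Z2t' bestX _ _.
have := minD _ PD' (tw M - q)%N; rewrite ltnS leq_subr subKn // leqNgt ltq /=.
move=> h; suff : false by []; apply: h => // j ltj.
by apply: leq_q; lia.
Qed.
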